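(* For every $\gamma>0$, the transfer function $H(\lambda)=\lambda\,C^*(\lambda^2I+\underline{A})^{-1}C\in\mathcal{L}(\mathbb{C})$ satisfies $$\sup_{\Re\lambda=\gamma}\left\|\lambda\,C^*(\lambda^2I+\underline{A})^{-1}C\right\|_{\mathcal{L}(\mathbb{C})}<\infty,$$ where the supremum is over $\lambda\in\mathbb{C}$ with real part $\gamma$.
   Context: Let $N\ge1$ be an integer and $\rho_0,\dots,\rho_{N-1}>0$ constants. Let $\underline{H}=\prod_{j=0}^{N-1}L^2(j,j+1)$ (complex valued, usual inner product) and $$V=\Big\{\underline{u}=(u_0,\dots,u_{N-1})\in\prod_{j=0}^{N-1}H^1(j,j+1):\ u_{N-1}(N)=0,\ u_{j-1}(j)=u_j(j),\ j=1,\dots,N-1\Big\},$$ with inner product $\langle\underline{u},\underline{\tilde u}\rangle_V=\sum_{j=0}^{N-1}\int_j^{j+1}\rho_j\partial_xu_j\,\partial_x\overline{\tilde u_j}\,dx$. Let $\underline{A}\,\underline{u}=(-\rho_j\partial_x^2u_j)_{0\le j\le N-1}$ with domain $$\mathcal{D}(\underline{A})=\Big\{\underline{u}\in V\cap\prod_{j=0}^{N-1}H^2(j,j+1):\ \rho_0\partial_xu_0(0)=0,\ \rho_{j-1}\partial_xu_{j-1}(j)=\rho_j\partial_xu_j(j),\ 1\le j\le N-1\Big\}.$$ This is a positive self-adjoint operator on $\underline{H}$ with $\mathcal{D}(\underline{A}^{1/2})=V$; it extends to a bounded operator $V\to V'$, where $V'$ is the dual of $V$ with respect to the pivot space $\underline{H}$.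 For $\Re\lambda>0$, $\lambda^2I+\underline{A}:V\to V'$ is an isomorphism and $(\lambda^2I+\underline{A})^{-1}:V'\to V$ denotes its inverse. The operator $C\in\mathcal{L}(\mathbb{C},V')$ is $Ck=k\left(\tfrac{1}{\sqrt{\rho_0}}\delta_0,0,\dots,0\right)$, where $\delta_0$ is the Dirac mass at $x=0$ (acting on the component $u_0$), and its adjoint $C^*\in\mathcal{L}(V,\mathbb{C})$ is $C^*\underline{u}=\tfrac{1}{\sqrt{\rho_0}}u_0(0)$. *)

(* Defs.v *)
From HB Require Import structures.
From mathcomp Require Import all_boot all_order all_algebra.
From mathcomp Require Import all_classical all_reals all_analysis.
From mathcomp Require Import complex.

Set Implicit Arguments.
Unset Strict Implicit.
Unset Printing Implicit Defensive.

Import Order.TTheory GRing.Theory Num.Theory.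
Import numFieldNormedType.Exports.

Local Open Scope classical_set_scope.
Local Open Scope ring_scope.
Local Open Scope complex_scope.

Section Sobolev.
Context {R : realType}.
Implicit Types (a b : R) (u g : R -> R[i]) (phi : R -> R).

Definition reF u : R -> R := fun x => complex.Re (u x).
Definition imF u : R -> R := fun x => complex.Im (u x).

Definition cint (D : set R) u : R[i] :=
  (\int[lebesgue_measure]_(x in D) reF u x)
  +i* (\int[lebesgue_measure]_(x in D) imF u x).

Definition L2 a b : set (R -> R[i]) := [set u |
  (reF u \_ `]a, b[) \in Lfun lebesgue_measure 2%:E /\
  (imF u \_ `]a, b[) \in Lfun lebesgue_measure 2%:E].

(* C^1 functions with compact support in ]a, b[. *)
Definition testfun a b : set (R -> R) := [set phi : R -> R |
  [/\ forall x : R, derivable phi x 1,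
      continuous (derive1 phi) &
      exists c d, [/\ a < c, d < b & forall x, x \notin `[c, d] -> phi x = 0]]].

Definition weak_deriv a b u g := forall phi, testfun a b phi ->
  cint `]a, b[ (fun x => u x * (derive1 phi x)%:C) =
  - cint `]a, b[ (fun x => g x * (phi x)%:C).

(* An element of H^1(a, b) is represented by its continuous representative on
   [a, b], extended by 0 outside [a, b]; thus Leibniz equality on H1 is
   equality in H^1(a, b), and pointwise values are traces. *)
Definition H1 a b : set (R -> R[i]) := [set u |
  [/\ {within `[a, b], continuous (reF u)},
      {within `[a, b], continuous (imF u)},
      forall x, x \notin `[a, b] -> u x = 0 &
      exists2 g, L2 a b g & weak_deriv a b u g]].

(* A representative in L^2(a, b) of the derivative; it is unique a.e. *)
Definition wderiv a b u : R -> R[i] :=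
  xget (fun=> 0) [set g | L2 a b g /\ weak_deriv a b u g].

End Sobolev.

Section Network.
Context {R : realType} {n : nat} (rho : 'I_n.+1 -> R).

Definition vec : Type := 'I_n.+1 -> R -> R[i].
Implicit Types (u h : vec) (lam k : R[i]).

Definition dotH u (v : vec) : R[i] :=
  \sum_(j < n.+1) cint `]j%:R, j.+1%:R[ (fun x => u j x * (v j x)^*).

Definition V : set vec := [set u |
  [/\ forall j : 'I_n.+1, H1 j%:R j.+1%:R (u j),
      u ord_max n.+1%:R = 0 &
      forall i j : 'I_n.+1, j = i.+1 :> nat -> u i j%:R = u j j%:R]].

Definition dx u : vec := fun j : 'I_n.+1 => wderiv j%:R j.+1%:R (u j).

Definition dotV u (v : vec) : R[i] :=
  \sum_(j < n.+1) cint `]j%:R, j.+1%:R[ (fun x => (rho j)%:C * dx u j x * (dx v j x)^*).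

(* p j is the continuous representative of the derivative of u j, so that
   p : H^1 says that u is H^2 on each interval *)
Definition DA : set vec := [set u | V u /\ exists p : vec,
  [/\ forall j : 'I_n.+1, H1 j%:R j.+1%:R (p j) /\ weak_deriv j%:R j.+1%:R (u j) (p j),
      (rho ord0)%:C * p ord0 0 = 0 &
      forall i j : 'I_n.+1, j = i.+1 :> nat ->
        (rho i)%:C * p i j%:R = (rho j)%:C * p j j%:R]].

Definition A u : vec := fun j x => - (rho j)%:C * dx (dx u) j x.

Definition pivot h : V -> R[i] := fun v => dotH h (val v).

Definition AV u : V -> R[i] := fun v => dotV u (val v).

Definition Lop lam u : V -> R[i] :=
  fun v => pivot (fun j x => lam ^+ 2 * u j x) v + AV u v.

Definition resolvent lam : (V -> R[i]) -> vec := 'pinv_(fun=> 0) V (Lop lam).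

Definition Cop k : V -> R[i] :=
  fun v => k * ((Num.sqrt (rho ord0))^-1)%:C * (val v ord0 0)^*.

Definition Cstar u : R[i] := ((Num.sqrt (rho ord0))^-1)%:C * u ord0 0.

Definition transfer lam : R[i] -> R[i] :=
  fun k => lam * Cstar (resolvent lam (Cop k)).

End Network.

Definition opnorm {R : realType} (T : R[i] -> R[i]) : \bar R :=
  ereal_sup [set (Normc.normc (T k))%:E | k in [set k | Normc.normc k <= 1]].

(* Main.v *)
Require Import Defs.
From mathcomp Require Import all_boot all_order all_algebra.
From mathcomp Require Import all_classical all_reals all_analysis.
From mathcomp Require Import measurable_realfun.
From mathcomp Require Import complex ring lra.

(* Only an a priori estimate is needed: where the equation
   [lam^2 u + A u = C k] has no solution in [V], [resolvent] takes the value
   [0].  Let [u] in [V] be a solution, [Re lam = gamma], [w = u_0(0)].  Testing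
   against [u] and multiplying by the conjugate of [lam] gives, in real part,
   [gamma |lam|^2 ||u||^2 <= |k| |lam w| / sqrt rho_0].
   On the first edge, test against the real function
   [phi(x) = (1 - x)^2 sin (nu x)], with [nu = (|Im lam| + 1) / sqrt rho_0]: as
   [phi(0) = phi(1) = phi'(1) = 0], two integrations by parts give
   [rho_0 nu w = int u_0 (lam^2 phi - rho_0 phi'')].  The terms of order
   [|lam|^2] cancel in the parenthesis, which is therefore [O(nu)] uniformly on
   [Re lam = gamma], whence [|w| <= K ||u||].  Together,
   [|lam w| <= K^2 |k| / (gamma sqrt rho_0)].
   The integration by parts for a weak derivative uses cutoff functions
   tending to the indicator function of the interval, and the a.e. uniqueness
   of weak derivatives follows from Lebesgue's differentiation theorem. *)

Set Implicit Arguments.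
Unset Strict Implicit.
Unset Printing Implicit Defensive.

Import Order.TTheory GRing.Theory Num.Theory.
Import numFieldNormedType.Exports.

Local Open Scope classical_set_scope.
Local Open Scope ring_scope.
Local Open Scope complex_scope.

(** * Integrals over open intervals *)

Section RealCalculus.
Context {R : realType}.
Local Notation mu := (@lebesgue_measure R).
Implicit Types (a b c d k x : R) (f g phi psi : R -> R).

(** The two components of [cint] over an open interval are convertible to such integrals, so complex
    identities reduce to real ones. *)
Definition ooint a b f : R := \int[mu]_(x in `]a, b[) f x.

Definition oointegrable a b f := mu.-integrable `]a, b[ (EFin \o f).

Lemma oointegrableD a b f g : oointegrable a b f -> oointegrable a b g ->
  oointegrable a b (fun x => f x + g x).
Proof. by move=> intf intg; exact: (integrableD _ intf intg). Qed.

Lemma oointegrableB a b f g : oointegrable a b f -> oointegrable a b g ->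
  oointegrable a b (fun x => f x - g x).
Proof. by move=> intf intg; exact: (integrableB _ intf intg). Qed.

Lemma oointegrableZ a b k f : oointegrable a b f ->
  oointegrable a b (fun x => k * f x).
Proof. by move=> intf; exact: (integrableZl _ _ intf). Qed.

Lemma oointegrable_norm a b f : oointegrable a b f ->
  oointegrable a b (fun x => `|f x|).
Proof. exact: integrable_norm. Qed.

Lemma oointegrable_subset a b c d f : a <= c -> d <= b ->
  oointegrable a b f -> oointegrable c d f.
Proof.
move=> ac db intf; apply: (integrableS _ _ _ intf) => //= x /=.
rewrite !in_itv/= => /andP[cx xd].
by rewrite (le_lt_trans ac cx) (lt_le_trans xd db).
Qed.

Lemma oointegrable_within a b f : {within `[a, b], continuous f} ->
  oointegrable a b f.
Proof.
move=> /(continuous_compact_integrable (@segment_compact _ a b)) intf.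
by apply: (integrableS _ _ _ intf) => //; exact: subset_itv_oo_cc.
Qed.

(** On the compact segment the continuous factor is measurable and bounded. *)
Lemma oointegrableM a b f g : oointegrable a b f ->
  {within `[a, b], continuous g} -> oointegrable a b (fun x => f x * g x).
Proof.
move=> intf cg; rewrite /oointegrable; apply: (integrableMl _ intf) => //=.
  have := continuous_compact_integrable (@segment_compact _ a b) cg.
  move=> /measurable_int/measurable_EFinP.
  by apply: measurable_funS => //; exact: subset_itv_oo_cc.
have := continuous_compact cg (@segment_compact _ a b).
move/compact_bounded => [M [Mr HM]]; exists M; split => // x Mx y /= yab.
by apply: (HM x Mx); exists y => //=; exact: subset_itv_oo_cc.
Qed.

Lemma ointD a b f g : oointegrable a b f -> oointegrable a b g ->
  ooint a b (fun x => f x + g x) = ooint a b f + ooint a b g.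
Proof. by move=> *; apply: RintegralD. Qed.

Lemma ointB a b f g : oointegrable a b f -> oointegrable a b g ->
  ooint a b (fun x => f x - g x) = ooint a b f - ooint a b g.
Proof. by move=> *; apply: RintegralB. Qed.

Lemma ointZ a b k f : oointegrable a b f ->
  ooint a b (fun x => k * f x) = k * ooint a b f.
Proof. by move=> *; apply: RintegralZl. Qed.

Lemma eq_ooint a b f g : (forall x, a < x < b -> f x = g x) ->
  ooint a b f = ooint a b g.
Proof.
by move=> fg; apply: eq_Rintegral => x; rewrite inE/= in_itv/=; exact: fg.
Qed.

Lemma le_ooint a b f g : oointegrable a b f -> oointegrable a b g ->
  (forall x, a < x < b -> f x <= g x) -> ooint a b f <= ooint a b g.
Proof.
by move=> intf intg fg; apply: le_Rintegral => // x/=; rewrite in_itv/=; exact: fg.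
Qed.

Lemma ooint_ge0 a b f : (forall x, 0 <= f x) -> 0 <= ooint a b f.
Proof. by move=> f0; apply: Rintegral_ge0. Qed.

Lemma le_norm_ooint a b f : oointegrable a b f ->
  `|ooint a b f| <= ooint a b (fun x => `|f x|).
Proof. by move=> intf; exact: le_normr_Rintegral. Qed.

Lemma ooint_derive1 a b f : a < b -> (forall x, derivable f x 1) ->
  continuous (derive1 f) -> ooint a b (derive1 f) = f b - f a.
Proof.
move=> ab df cf.
have cdf : {within `[a, b], continuous (derive1 f)}.
  exact: continuous_subspaceT.
have cf' x : {for x, continuous f}.
  by apply: differentiable_continuous; exact/derivable1_diffP.
rewrite /ooint Rintegral_itv_bndo_bndc//; last exact: oointegrable_within.
rewrite Rintegral_itv_obnd_cbnd//; last first.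
  have := continuous_compact_integrable (@segment_compact _ a b) cdf.
  by move=> /(integrableS _ _ _); apply => //; exact: subset_itv_oc_cc.
rewrite /Rintegral (@continuous_FTC2 _ (derive1 f) f)//.
split=> //.
- by apply: cvg_at_right_filter; exact: cf'.
- by apply: cvg_at_left_filter; exact: cf'.
Qed.

Lemma eq_ooint_ae a b f g : oointegrable a b f -> oointegrable a b g ->
  {ae mu, forall x, a < x < b -> f x = g x} -> ooint a b f = ooint a b g.
Proof.
move=> intf intg fg; congr fine; apply: ae_eq_integral => //.
- exact: (measurable_int mu).
- exact: (measurable_int mu).
apply: (@filterS _ _ (ae_filter_ringOfSetsType mu)) fg => x /= fg.
by rewrite in_itv/= => /fg ->.
Qed.

Definition C1 psi := (forall x, derivable psi x 1) /\ continuous (derive1 psi).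

Lemma continuous_C1 psi : C1 psi -> continuous psi.
Proof.
move=> [dpsi _] x.
by apply: differentiable_continuous; exact/derivable1_diffP.
Qed.

Lemma derive1_mul phi psi : C1 phi -> C1 psi ->
  derive1 (fun x => phi x * psi x) =
  fun x => derive1 phi x * psi x + phi x * derive1 psi x.
Proof.
move=> [dphi _] [dpsi _]; apply/funext => x.
rewrite !derive1E deriveM//= addrC; congr (_ + _).
by rewrite [RHS]mulrC.
Qed.

Lemma C1M phi psi : C1 phi -> C1 psi -> C1 (fun x => phi x * psi x).
Proof.
move=> C1phi C1psi; split.
  by move=> x; apply: derivableM; [case: C1phi|case: C1psi].
rewrite derive1_mul// => x; apply: cvgD; apply: cvgM.
- by case: C1phi => _; exact.
- exact: continuous_C1.
- exact: continuous_C1.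
- by case: C1psi => _; exact.
Qed.

End RealCalculus.

(** * Cutoff functions *)

Section Cutoff.
Context {R : realType}.
Implicit Types (a b p d e t x : R) (f g : R -> R).

Definition pospart t : R := Num.max t 0.

Lemma continuous_pospart : continuous pospart.
Proof. by move=> t; apply: continuous_max => //; exact: cst_continuous. Qed.

(** A quadratic bound on the first-order remainder, checked by cases on the signs of [t] and
    [t + h]. It lets splines built from squared positive parts be differentiated without separate
    treatment of the knots. *)
Lemma pospart_sqr_diff t h :
  `|pospart (t + h) ^+ 2 - pospart t ^+ 2 - 2 * pospart t * h| <= h ^+ 2.
Proof.
rewrite /pospart !maxEge ler_norml.
by case: ifPn; rewrite -?ltNge; case: ifPn; rewrite -?ltNge => *; nra.
Qed.

Lemma is_derive_quadratic f (C l x : R) : 0 <= C ->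
  (forall h, `|f (x + h) - f x - l * h| <= C * h ^+ 2) -> is_derive x 1 f l.
Proof.
move=> C0 fl.
suff H : h^-1 *: (f (h *: 1 + x) - f x) @[h --> 0^'] --> l.
  by apply: DeriveDef; [apply/cvg_ex; exists l | exact: cvg_lim].
apply/cvgrPdist_le => /= e e0; near=> h.
have h0 : h != 0 by near: h; exact: nbhs_dnbhs_neq.
(* The denominator is [C + 1] because [C] may be [0]. *)
have he : `|h| <= e / (C + 1).
  by near: h; apply: dnbhs0_le; rewrite divr_gt0// ltr_wpDl.
have := fl h; rewrite scaler1 [h + x]addrC [_ *: _]/(h^-1 * _) => H.
have -> : l - h^-1 * (f (x + h) - f x) = - (h^-1 * (f (x + h) - f x - l * h)).
  by field.
rewrite normrN normrM normfV ler_pdivrMl ?normr_gt0//.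
apply: (le_trans H); rewrite -real_normK ?num_real// expr2 mulrCA.
rewrite ler_wpM2l// (le_trans (ler_wpM2l C0 he))// mulrCA ger_pMr//.
by rewrite ler_pdivrMr ?ltr_wpDl// mul1r lerDl.
Unshelve. all: by end_near. Qed.

(* A C^1 step from 0 to 1: its derivative [dstep] is the hat function of height 2
   supported in [0, 1]. *)
Definition step t : R :=
  2 * pospart t ^+ 2 - 4 * pospart (t - 2^-1) ^+ 2 + 2 * pospart (t - 1) ^+ 2.

Definition dstep t : R :=
  4 * pospart t - 8 * pospart (t - 2^-1) + 4 * pospart (t - 1).

(** The constant is [2 + 4 + 2], the sum of the absolute coefficients of the squared positive parts
    in [step]. *)
Lemma step_diff t h : `|step (t + h) - step t - dstep t * h| <= 8 * h ^+ 2.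
Proof.
rewrite /step /dstep ![t + h - _]addrAC.
have := pospart_sqr_diff t h; have := pospart_sqr_diff (t - 2^-1) h.
have := pospart_sqr_diff (t - 1) h.
by rewrite !ler_norml => /andP[? ?] /andP[? ?] /andP[? ?]; apply/andP; split; nra.
Qed.

Lemma step_le0 t : t <= 0 -> step t = 0.
Proof.
by move=> t0; rewrite /step /pospart !max_r//; [ring|lra|lra].
Qed.

Lemma step_ge1 t : 1 <= t -> step t = 1.
Proof.
by move=> t1; rewrite /step /pospart !max_l//; [field|lra|lra|lra].
Qed.

Lemma step_itv t : 0 <= step t <= 1.
Proof.
rewrite /step /pospart !maxEge.
by case: ifPn; rewrite -?ltNge; case: ifPn; rewrite -?ltNge;
   case: ifPn; rewrite -?ltNge => *; nra.
Qed.

Lemma dstep_ge0 t : 0 <= dstep t.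
Proof.
rewrite /dstep /pospart !maxEge.
by case: ifPn; rewrite -?ltNge; case: ifPn; rewrite -?ltNge;
   case: ifPn; rewrite -?ltNge => *; lra.
Qed.

Lemma dstep_out t : ~~ (0 < t < 1) -> dstep t = 0.
Proof.
rewrite negb_and -!leNgt => /orP[t0|t1]; rewrite /dstep /pospart.
  by rewrite !max_r//; [ring|lra|lra].
by rewrite !max_l//; [field|lra|lra|lra].
Qed.

(** For [0 < d] this rises from [0] to [1] on [[p, p + d]]; its derivative [dramp p d] is a
    nonnegative bump of mass [1] there, an approximate Dirac mass as [d] tends to [0]. *)
Definition ramp p d x : R := step ((x - p) / d).
Definition dramp p d x : R := dstep ((x - p) / d) / d.

Lemma is_derive_ramp p d x : is_derive x 1 (ramp p d) (dramp p d x).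
Proof.
apply: (@is_derive_quadratic _ (8 * d^-1 ^+ 2)) => [|h].
  by rewrite mulr_ge0// sqr_ge0.
rewrite /ramp /dramp (_ : (x + h - p) / d = (x - p) / d + h / d); last by ring.
have := step_diff ((x - p) / d) (h / d).
by rewrite exprMn [h ^+ 2 * _]mulrC -mulrA [h / d]mulrC !mulrA.
Qed.

Lemma derive1_ramp p d : derive1 (ramp p d) = dramp p d.
Proof.
by apply/funext => x; rewrite derive1E; have [_ ->] := is_derive_ramp p d x.
Qed.

Lemma continuous_dramp p d : continuous (dramp p d).
Proof.
move=> x; rewrite /dramp /dstep.
have caff q : {for x, continuous (fun y : R => pospart ((y - p) / d - q))}.
  apply: (@continuous_comp _ _ _ (fun y : R => (y - p) / d - q) pospart).
    apply: continuousB; last exact: cst_continuous.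
    apply: continuousM; last exact: cst_continuous.
    by apply: continuousB => //; exact: cst_continuous.
  exact: continuous_pospart.
have := caff 0; under [fun y => pospart (_ - 0)]eq_fun do rewrite subr0.
move=> c0; apply: cvgM; last exact: cvg_cst.
apply: cvgD; first apply: cvgB.
all: by apply: cvgM => //; first [exact: cvg_cst | exact: caff].
Qed.

Lemma dramp_ge0 p d x : 0 <= d -> 0 <= dramp p d x.
Proof. by move=> d0; rewrite divr_ge0// dstep_ge0. Qed.

Lemma dramp_out p d x : 0 < d -> ~~ (p < x < p + d) -> dramp p d x = 0.
Proof.
move=> d0 pxd; rewrite /dramp dstep_out ?mul0r//.
by rewrite ltr_pdivlMr// ltr_pdivrMr// mul0r mul1r subr_gt0 ltrBlDl.
Qed.

Lemma ramp_le p d x : 0 < d -> x <= p -> ramp p d x = 0.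
Proof. by move=> d0 xp; rewrite /ramp step_le0// ler_pdivrMr// mul0r subr_le0. Qed.

Lemma ramp_ge p d x : 0 < d -> p + d <= x -> ramp p d x = 1.
Proof.
by move=> d0 xp; rewrite /ramp step_ge1// ler_pdivlMr// mul1r lerBrDl.
Qed.

(** The integral is an average of [f] over []p, p + d[], since [dramp p d] is nonnegative with mass
    [1]. *)
Lemma ooint_dramp_mean a b p d f (l e : R) : 0 < d -> a <= p -> p + d <= b ->
  {within `[a, b], continuous f} ->
  (forall x, p < x < p + d -> `|f x - l| <= e) ->
  `|ooint a b (fun x => f x * dramp p d x) - l| <= e.
Proof.
move=> d0 ap db cf fl.
have ab : a < b by lra.
have cr : {within `[a, b], continuous (dramp p d)}.
  by apply: continuous_subspaceT; exact: continuous_dramp.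
have ir := oointegrable_within cr.
have r1 : ooint a b (dramp p d) = 1.
  rewrite -derive1_ramp ooint_derive1//.
  - by rewrite ramp_ge// ramp_le// subr0.
  - by move=> x; have [] := is_derive_ramp p d x.
  - by rewrite derive1_ramp; exact: continuous_dramp.
have ifr : oointegrable a b (fun x => f x * dramp p d x).
  by apply: oointegrableM cr; exact: oointegrable_within.
(* Writing [l] as [l] times the mass of [dramp p d] puts both terms under one integral. *)
rewrite -[l in _ - l]mulr1 -r1 -ointZ// -ointB//; last exact: oointegrableZ.
have i1 : oointegrable a b (fun x => f x * dramp p d x - l * dramp p d x).
  by apply: oointegrableB => //; exact: oointegrableZ.
apply: (le_trans (le_norm_ooint i1)).
rewrite -[leRHS]mulr1 -r1 -ointZ//; apply: le_ooint => [||x _].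
- exact: oointegrable_norm.
- exact: oointegrableZ.
have [px|px] := boolP (p < x < p + d); last by rewrite dramp_out// !mulr0 subr0 normr0.
have r0 := dramp_ge0 p x (ltW d0).
by rewrite -mulrBl normrM [X in _ * X]ger0_norm// ler_wpM2r ?fl.
Qed.

End Cutoff.

(** * Weak derivatives of real functions *)

Section WeakDerivative.
Context {R : realType}.
Local Notation mu := (@lebesgue_measure R).
Implicit Types (a b d e x : R) (f g h phi : R -> R).

(** Test functions are real, so [weak_deriv] decouples into this relation for the real parts and for
    the imaginary parts. *)
Definition weak_derivR a b f g := forall phi, testfun a b phi ->
  ooint a b (fun x => f x * derive1 phi x) =
  - ooint a b (fun x => g x * phi x).

Lemma C1_testfun a b phi : testfun a b phi -> C1 phi.
Proof. by case. Qed.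

(** When [0 < d] and [4 * d <= b - a], it rises on [[a + d, a + 2 * d]], equals [1] up to
    [b - 2 * d], and returns to [0] at [b - d]: the margin [d] at each end makes it an admissible
    test function. *)
Definition cutoff a b d x : R := ramp (a + d) d x - ramp (b - 2 * d) d x.

Lemma is_derive_cutoff a b d x :
  is_derive x 1 (cutoff a b d) (dramp (a + d) d x - dramp (b - 2 * d) d x).
Proof. by apply: is_deriveB; exact: is_derive_ramp. Qed.

Lemma derive1_cutoff a b d :
  derive1 (cutoff a b d) = fun x => dramp (a + d) d x - dramp (b - 2 * d) d x.
Proof.
by apply/funext => x; rewrite derive1E; have [_ ->] := is_derive_cutoff a b d x.
Qed.

Lemma testfun_cutoff a b d : 0 < d -> 4 * d <= b - a ->
  testfun a b (cutoff a b d).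
Proof.
move=> d0 db; split.
- by move=> x; have [] := is_derive_cutoff a b d x.
- by rewrite derive1_cutoff => x; apply: cvgB; exact: continuous_dramp.
- exists (a + d), (b - d); split; [lra|lra|move=> x].
  rewrite in_itv/= negb_and -!ltNge => /orP[xa|xb]; rewrite /cutoff.
    by rewrite !ramp_le ?subrr//; lra.
  by rewrite !ramp_ge ?subrr//; lra.
Qed.

Lemma cutoff_norm_le1 a b d x : `|cutoff a b d x| <= 1.
Proof.
rewrite /cutoff /ramp ler_norml.
have /andP[? ?] := step_itv ((x - (a + d)) / d).
have /andP[? ?] := step_itv ((x - (b - 2 * d)) / d).
by apply/andP; split; lra.
Qed.

Lemma cutoff_eq1 a b d x : 0 < d ->
  a + 2 * d <= x <= b - 2 * d -> cutoff a b d x = 1.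
Proof.
by move=> d0 /andP[ax xb]; rewrite /cutoff ramp_ge ?ramp_le ?subr0//; lra.
Qed.

(** Test against cutoffs of width tending to [0]. Dominated convergence sends the side with [g] to
    its integral, while the derivative of the cutoff tends to the Dirac mass at [a] minus that at
    [b], tested on the continuous [f]. *)
Lemma weak_FTC a b f g : a < b -> {within `[a, b], continuous f} ->
  oointegrable a b g -> weak_derivR a b f g -> ooint a b g = f b - f a.
Proof.
move=> ab cf ig wd.
(* The factor [1 / 4] secures [4 * d n <= b - a], as [testfun_cutoff] demands. *)
pose d (n : nat) : R := (b - a) / 4 * n.+1%:R^-1.
have d0 n : 0 < d n by rewrite /d mulr_gt0// ?divr_gt0 ?subr_gt0.
have db n : 4 * d n <= b - a.
  rewrite /d mulrA [4 * _]mulrC divfK// ler_pdivrMr//.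
  by rewrite ler_peMr ?ler1n// subr_ge0 ltW.
have d_lt e : 0 < e -> \forall n \near \oo, d n < e.
  move=> e0.
  have ba4 : 0 < (b - a) / 4 by rewrite divr_gt0// subr_gt0.
  have e4 : 0 < e / ((b - a) / 4) by rewrite divr_gt0.
  have := near_infty_natSinv_lt (PosNum e4).
  by apply: filterS => n /=; rewrite ltr_pdivlMr// mulrC.
have cvg_g : ooint a b (fun x => g x * cutoff a b (d n) x) @[n --> \oo] -->
    ooint a b g.
  have ic n : oointegrable a b (fun x => g x * cutoff a b (d n) x).
    apply: oointegrableM => //; apply: continuous_subspaceT.
    exact: continuous_C1 (C1_testfun (testfun_cutoff (d0 n) (db n))).
  apply: fine_cvg; rewrite fineK; last exact: integrable_fin_num.
  apply: (@dominated_cvg _ _ _ mu `]a, b[ _ _ _ (fun x => `|g x|%:E)) => //.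
  - by move=> n; exact: (measurable_int mu (ic n)).
  - move=> x /=; rewrite in_itv/= => /andP[ax xb].
    (* At a fixed interior point the cutoff equals [1] as soon as [2 * d n] is below the distance to
       both ends. *)
    apply: cvg_near_cst.
    have r0 : 0 < Num.min (x - a) (b - x) / 2.
      by rewrite divr_gt0// lt_min !subr_gt0 ax.
    apply: filterS (d_lt _ r0) => n.
    rewrite ltr_pdivlMr// lt_min => /andP[xa bx].
    by rewrite cutoff_eq1 ?mulr1//; apply/andP; split; lra.
  - exact: oointegrable_norm.
  - move=> n x _ /=; rewrite lee_fin normrM ler_piMr//.
    exact: cutoff_norm_le1.
have cvg_f : ooint a b (fun x => f x * derive1 (cutoff a b (d n)) x)
    @[n --> \oo] --> f a - f b.
  have [_ fa fb] := (continuous_within_itvP f ab).1 cf.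
  apply/cvgrPdist_le => /= e e0.
  have e2 : 0 < e / 2 by rewrite divr_gt0.
  have [r /= r0 ra] := (cvgrPdist_le _ _).1 fa _ e2.
  have [s /= s0 sb] := (cvgrPdist_le _ _).1 fb _ e2.
  (* The two bumps lie within [2 * d n] of [a] and of [b], hence the half. *)
  have rs0 : 0 < Num.min r s / 2 by rewrite divr_gt0// lt_min r0.
  apply: filterS (d_lt _ rs0) => n.
  rewrite ltr_pdivlMr// lt_min => /andP[dr ds].
  move: (d n) (d0 n) (db n) dr ds => dn dn0 dnb dr ds.
  have ir p : oointegrable a b (fun x => f x * dramp p dn x).
    apply: oointegrableM; first exact: oointegrable_within.
    by apply: continuous_subspaceT; exact: continuous_dramp.
  rewrite (derive1_cutoff a b dn).
  under [fun x => f x * _]eq_fun do rewrite mulrBr.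
  rewrite ointB//.
  have Ha : `|ooint a b (fun x => f x * dramp (a + dn) dn x) - f a| <= e / 2.
    apply: ooint_dramp_mean => // [||x /andP[ax xd]]; [lra|lra|].
    rewrite distrC; apply: ra => /=; last lra.
    by rewrite ltr_distlC; apply/andP; split; lra.
  have Hb : `|ooint a b (fun x => f x * dramp (b - 2 * dn) dn x) - f b| <= e / 2.
    apply: ooint_dramp_mean => // [||x /andP[ax xd]]; [lra|lra|].
    rewrite distrC; apply: sb => /=; last lra.
    by rewrite ltr_distlC; apply/andP; split; lra.
  move: Ha Hb; rewrite !ler_norml => /andP[? ?] /andP[? ?].
  by apply/andP; split; lra.
have H : - ooint a b (fun x => g x * cutoff a b (d n) x) @[n --> \oo] -->
    f a - f b.
  under eq_fun do rewrite -(wd _ (testfun_cutoff (d0 _) (db _))).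
  exact: cvg_f.
have /(cvg_unique _ H) : - ooint a b (fun x => g x * cutoff a b (d n) x)
    @[n --> \oo] --> - ooint a b g by exact: cvgN.
by move=> /(_ (@norm_hausdorff _ _)) fg; lra.
Qed.

End WeakDerivative.

(** * Integration by parts and almost everywhere uniqueness for weak derivatives *)

Section WeakDerivativeTheory.
Context {R : realType}.
Local Notation mu := (@lebesgue_measure R).
Implicit Types (a b c d e x : R) (f g h phi psi : R -> R).

Lemma testfunM a b phi psi : C1 psi -> testfun a b phi ->
  testfun a b (fun x => psi x * phi x).
Proof.
move=> C1psi tphi; have [dpp cpp] := C1M C1psi (C1_testfun tphi); split => //.
case: tphi => _ _ [c [d [ac db phi0]]]; exists c, d; split => // x /phi0 ->.
by rewrite mulr0.
Qed.

Lemma testfun_out a b phi x : testfun a b phi -> ~~ (a < x < b) -> phi x = 0.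
Proof.
case=> _ _ [c [d [ac db phi0]]] xab; apply: phi0; apply: contra xab.
by rewrite in_itv/= => /andP[cx xd]; rewrite (lt_le_trans ac cx) (le_lt_trans xd db).
Qed.

Lemma testfun_subset a b c d phi : a <= c -> d <= b ->
  testfun c d phi -> testfun a b phi.
Proof.
move=> ac db [dphi cphi [p [q [cp qd phi0]]]]; split => //; exists p, q.
by split => //; [exact: le_lt_trans cp|exact: lt_le_trans db].
Qed.

Lemma ooint_subset a b c d f : a <= c -> d <= b ->
  (forall x, ~~ (c < x < d) -> f x = 0) -> ooint a b f = ooint c d f.
Proof.
move=> ac db f0; rewrite /ooint -(@setIidr _ `]a, b[ `]c, d[); last first.
  by move=> x /=; rewrite !in_itv/= => /andP[cx xd]; apply/andP; split; lra.
rewrite Rintegral_mkcondr; apply: eq_Rintegral => x _.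
rewrite patchE; case: ifPn => //; rewrite notin_setE/= in_itv/= => /negP cxd.
by rewrite f0.
Qed.

(** By the product rule [f * psi] has weak derivative [g * psi + f * psi'], to which [weak_FTC]
    applies. The product rule holds because [psi * phi] is a test function whenever [phi] is. *)
Lemma weak_FTC_mul a b f g psi : a < b -> {within `[a, b], continuous f} ->
  oointegrable a b g -> weak_derivR a b f g -> C1 psi ->
  ooint a b (fun x => g x * psi x) =
  f b * psi b - f a * psi a - ooint a b (fun x => f x * derive1 psi x).
Proof.
move=> ab cf ig wd C1psi.
have cw h : continuous h -> {within `[a, b], continuous h}.
  by move=> ch; exact: continuous_subspaceT.
have ipsi : oointegrable a b (fun x => g x * psi x).
  by apply: oointegrableM => //; apply/cw/continuous_C1.
have idpsi : oointegrable a b (fun x => f x * derive1 psi x).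
  apply: oointegrableM; first exact: oointegrable_within.
  by case: C1psi => _ /cw.
rewrite -(@weak_FTC _ a b (fun x => f x * psi x)
  (fun x => g x * psi x + f x * derive1 psi x))//.
- by rewrite ointD// addrK.
- by move=> x; apply: continuousM; [exact: cf|exact/cw/continuous_C1].
- exact: oointegrableD.
move=> phi tphi; have C1phi := C1_testfun tphi.
have cphi := cw _ (continuous_C1 C1phi).
have := wd _ (testfunM C1psi tphi); rewrite (derive1_mul C1psi C1phi) => H.
under [fun x => (g x * psi x + f x * derive1 psi x) * phi x]eq_fun do rewrite mulrDl.
rewrite ointD; last 2 first.
- exact: oointegrableM.
- exact: oointegrableM.
rewrite opprD; apply/eqP; rewrite eq_sym subr_eq; apply/eqP.
under eq_ooint do rewrite -mulrA.
rewrite -H -ointD; last 2 first.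
- under [fun x => f x * psi x * _]eq_fun do rewrite -mulrA [psi _ * _]mulrC mulrA.
  apply: oointegrableM; last by apply/cw/continuous_C1.
  apply: oointegrableM; first exact: oointegrable_within.
  by case: C1phi => _ /cw.
- exact: oointegrableM.
by apply: eq_ooint => x _; ring.
Qed.

(** Such an [h] is a weak derivative of [0], so [weak_FTC] on each []a, x[] makes its primitive
    vanish; Lebesgue differentiation then recovers [h] almost everywhere. *)
Lemma weak_zero_ae a b h : oointegrable a b h ->
  (forall phi, testfun a b phi -> ooint a b (fun x => h x * phi x) = 0) ->
  {ae mu, forall x, a < x < b -> h x = 0}.
Proof.
move=> ih wh.
have h0 x : a < x -> x <= b -> ooint a x h = 0.
  move=> ax xb; rewrite (@weak_FTC _ a x (cst 0))// ?subrr//.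
  - by move=> ?; exact: cvg_cst.
  - exact: oointegrable_subset ih.
  move=> phi tphi; have tphi' := testfun_subset (lexx a) xb tphi.
  rewrite -(@ooint_subset a b a x (fun y => h y * phi y))//; last first.
    by move=> y /(testfun_out tphi) ->; rewrite mulr0.
  rewrite wh// oppr0 /cst (@eq_ooint _ _ _ _ (fun=> 0 * 0)).
    by rewrite (@ointZ _ _ _ 0 (cst 0)) ?mul0r//; exact: integrable0.
  by move=> y _; rewrite !mul0r.
(* Extension by [0] gives a function integrable on the whole line, the setting of [FTC1]. *)
pose H := h \_ `]a, b[.
have iH : mu.-integrable setT (EFin \o H).
  by rewrite /H -restrict_EFin; apply/integrable_restrict => //=; rewrite setTI.
have locH : locally_integrable [set: R] H by exact: integrable_locally_restrict.
have iH' y : mu.-integrable `]a, y] (EFin \o H).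
  by apply: (integrableS _ _ _ iH).
have := FTC1 (a := BRight a) iH' locH.
apply: (@filterS _ _ (ae_filter_ringOfSetsType mu)) => x /= Hx /andP[ax xb].
have [_] := Hx ax; rewrite /H patchE mem_set/= ?in_itv/= ?ax// => <-.
rewrite derive1E.
(* Near an interior point the primitive is identically [0] by [h0], and so is its derivative. *)
rewrite (@near_eq_derive _ _ _ _ (cst 0)) ?derive_cst//.
have : \forall y \near x, y \in `]a, b[.
  by apply: near_in_itvoo; rewrite in_itv/= ax.
apply: filterS => y; rewrite in_itv/= => /andP[ay yb].
rewrite /cst -(h0 _ ay (ltW yb)) /ooint Rintegral_itv_bndo_bndc; last first.
  exact: oointegrable_subset (lexx a) (ltW yb) ih.
apply: eq_Rintegral => z; rewrite inE/= in_itv/= => /andP[az zy].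
by rewrite patchE mem_set//= in_itv/= az (le_lt_trans zy).
Qed.

Lemma weak_derivR_unique a b f g h : oointegrable a b g ->
  oointegrable a b h -> weak_derivR a b f g -> weak_derivR a b f h ->
  {ae mu, forall x, a < x < b -> g x = h x}.
Proof.
move=> ig ih wg wh.
have igh : oointegrable a b (fun x => g x - h x) by exact: oointegrableB.
have wgh phi : testfun a b phi -> ooint a b (fun x => (g x - h x) * phi x) = 0.
  move=> tphi.
  have cphi : {within `[a, b], continuous phi}.
    exact/continuous_subspaceT/continuous_C1/C1_testfun/tphi.
  under [fun x => (g x - h x) * _]eq_fun do rewrite mulrBl.
  rewrite ointB; [|exact: oointegrableM..].
  by have := wg _ tphi; rewrite (wh _ tphi) => /oppr_inj ->; rewrite subrr.
have := weak_zero_ae igh wgh.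
apply: (@filterS _ _ (ae_filter_ringOfSetsType mu)) => x /= ghx /ghx.
by move/eqP; rewrite subr_eq0 => /eqP.
Qed.

End WeakDerivativeTheory.

(** * Complex-valued functions *)

Section ComplexValued.
Context {R : realType}.
Local Notation mu := (@lebesgue_measure R).
Implicit Types (a b c d e x : R) (u g : R -> R[i]) (f h phi psi : R -> R).

Lemma Re_mulrC (z : R[i]) (r : R) : complex.Re (z * r%:C) = complex.Re z * r.
Proof. by case: z => x y; rewrite /= mulr0 subr0. Qed.

Lemma Im_mulrC (z : R[i]) (r : R) : complex.Im (z * r%:C) = complex.Im z * r.
Proof. by case: z => x y; rewrite /= mulr0 add0r. Qed.

Lemma weak_derivE a b u g : weak_deriv a b u g <->
  weak_derivR a b (reF u) (reF g) /\ weak_derivR a b (imF u) (imF g).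
Proof.
have E v f : cint `]a, b[ (fun x => v x * (f x)%:C) =
    (ooint a b (fun x => reF v x * f x)) +i* (ooint a b (fun x => imF v x * f x)).
  rewrite /cint /ooint /reF /imF; congr (_ +i* _); apply: eq_Rintegral => x _.
    by rewrite Re_mulrC.
  by rewrite Im_mulrC.
split=> [wd|[wr wi] phi tphi].
  by split=> phi tphi; have := wd _ tphi; rewrite !E => -[].
by rewrite !E wr// wi.
Qed.

Lemma Lfun2_within a b f : {within `[a, b], continuous f} ->
  f \_ `]a, b[ \in Lfun mu 2%:E.
Proof.
move=> cf.
have if2 : oointegrable a b (fun x => f x * f x).
  by apply: oointegrableM => //; exact: oointegrable_within.
have mf := measurable_int _ (oointegrable_within cf).
rewrite inE; apply/andP; split; rewrite inE/=.
  by apply/(measurable_restrictT _ _).1 => //; exact/measurable_EFinP.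
rewrite /finite_norm unlock; apply: poweR_lty.
have : mu.-integrable setT (EFin \o ((fun x => f x * f x) \_ `]a, b[)).
  by rewrite -restrict_EFin; apply/integrable_restrict => //=; rewrite setTI.
move=> /integrableP[_]; apply: le_lt_trans.
rewrite le_eqVlt; apply/orP; left; apply/eqP; apply: eq_integral => x _ /=.
rewrite !patchE; case: ifPn => _; last by rewrite !normr0 powR0.
by rewrite powR_mulrn// normrM.
Qed.

Lemma oointegrable_mul_Lfun2 a b f h : f \_ `]a, b[ \in Lfun mu 2%:E ->
  h \_ `]a, b[ \in Lfun mu 2%:E -> oointegrable a b (fun x => f x * h x).
Proof.
move=> f2 h2; have := Lfun2_mul_Lfun1 f2 h2.
move=> /Lfun1_integrable.
rewrite (_ : _ \* _ = (fun x => f x * h x) \_ `]a, b[); last first.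
  by apply/funext => x /=; rewrite !patchE; case: ifPn; rewrite ?mulr0.
by rewrite -restrict_EFin => /integrable_restrict; rewrite setTI; exact.
Qed.

Lemma oointegrable_Lfun2 a b f : f \_ `]a, b[ \in Lfun mu 2%:E ->
  oointegrable a b f.
Proof.
move=> f2; have c1 : {within `[a, b], continuous (cst 1 : R -> R)}.
  by move=> ?; exact: cvg_cst.
have := oointegrable_mul_Lfun2 f2 (Lfun2_within c1).
by under [fun x => _]eq_fun do rewrite mulr1.
Qed.

Lemma H1_wderiv a b u : H1 a b u ->
  L2 a b (wderiv a b u) /\ weak_deriv a b u (wderiv a b u).
Proof.
move=> [_ _ _ [g g2 ug]].
exact: (@xgetPex _ (fun=> 0) [set g | L2 a b g /\ weak_deriv a b u g]
  (ex_intro _ g (conj g2 ug))).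
Qed.

(** The value [0] outside [[a, b]] is the normalization of representatives that [H1] imposes. *)
Definition realext a b phi : R -> R[i] :=
  fun x => if x \in `[a, b] then (phi x)%:C else 0.

(** The derivative of [phi * psi] has integral [0], because the test function [psi] vanishes at both
    ends. *)
Lemma weak_derivR_C1 a b phi : a < b -> C1 phi ->
  weak_derivR a b phi (derive1 phi).
Proof.
move=> ab C1phi psi tpsi; have C1psi := C1_testfun tpsi.
have cw h : continuous h -> oointegrable a b h.
  by move=> ch; apply/oointegrable_within; exact: continuous_subspaceT.
have [dp cp] := C1M C1phi C1psi.
have := ooint_derive1 ab dp cp.
rewrite (derive1_mul C1phi C1psi) ointD.
- rewrite !(testfun_out tpsi) ?mulr0 ?subr0 ?ltxx ?andbF//.
  by move/eqP; rewrite addrC addr_eq0 => /eqP.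
- apply: cw => x; apply: cvgM; first by case: C1phi => _; exact.
  exact: continuous_C1.
- apply: cw => x; apply: cvgM; last by case: C1psi => _; exact.
  exact: continuous_C1.
Qed.

Lemma reF_realext a b phi x : a <= x <= b -> reF (realext a b phi) x = phi x.
Proof. by move=> xab; rewrite /reF /realext in_itv/= xab. Qed.

Lemma imF_realext a b phi : imF (realext a b phi) = cst 0.
Proof. by apply/funext => x; rewrite /imF /realext; case: ifP. Qed.

Lemma H1_realext a b phi : a < b -> C1 phi -> H1 a b (realext a b phi).
Proof.
move=> ab C1phi; have cphi := continuous_C1 C1phi.
have [_ cdphi] := C1phi.
split.
- apply: (@subspace_eq_continuous _ _ _ phi); last exact: continuous_subspaceT.
  by move=> x; rewrite inE/= in_itv/= => xab; exact/esym/reF_realext.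
- by rewrite imF_realext => ?; exact: cvg_cst.
- by move=> x /negbTE xab; rewrite /realext xab.
exists (fun x => (derive1 phi x)%:C).
  split; first by apply: Lfun2_within; exact: continuous_subspaceT.
  by apply: (@Lfun2_within _ _ (cst 0)) => ?; exact: cvg_cst.
apply/weak_derivE; rewrite imF_realext; split=> psi tpsi.
  rewrite -(weak_derivR_C1 ab C1phi tpsi); apply: eq_ooint => x /andP[ax xb].
  by rewrite reF_realext// !ltW.
rewrite [X in _ = - X](@eq_ooint _ _ _ _ (fun=> 0 * 0)).
  rewrite (@eq_ooint _ _ _ _ (fun=> 0 * 0)).
    by rewrite (@ointZ _ _ _ 0 (cst 0)) ?mul0r ?oppr0//; exact: integrable0.
  by move=> x _; rewrite !mul0r.
by move=> x _; rewrite /imF/= !mul0r.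
Qed.

(** [wderiv] is a chosen representative, so it can be identified with the classical derivative only
    almost everywhere, through uniqueness of weak derivatives. *)
Lemma wderiv_realext a b phi : a < b -> C1 phi ->
  {ae mu, forall x, a < x < b ->
     reF (wderiv a b (realext a b phi)) x = derive1 phi x /\
     imF (wderiv a b (realext a b phi)) x = 0}.
Proof.
move=> ab C1phi; have [_ cdphi] := C1phi.
have [[g2r g2i] /weak_derivE[wr wi]] := H1_wderiv (H1_realext ab C1phi).
have aer : {ae mu, forall x, a < x < b ->
     reF (wderiv a b (realext a b phi)) x = derive1 phi x}.
  apply: (weak_derivR_unique _ _ wr).
  - exact: oointegrable_Lfun2.
  - by apply: oointegrable_within; exact: continuous_subspaceT.
  move=> psi tpsi; rewrite -(weak_derivR_C1 ab C1phi tpsi).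
  by apply: eq_ooint => x /andP[ax xb]; rewrite reF_realext// !ltW.
have aei : {ae mu, forall x, a < x < b ->
     imF (wderiv a b (realext a b phi)) x = 0}.
  apply: weak_zero_ae; first exact: oointegrable_Lfun2.
  move=> psi tpsi; apply/eqP; rewrite -oppr_eq0 -wi// imF_realext.
  rewrite (@eq_ooint _ _ _ _ (fun=> 0 * 0)).
    by rewrite (@ointZ _ _ _ 0 (cst 0)) ?mul0r//; exact: integrable0.
  by move=> x _; rewrite !mul0r.
apply: (@filterS2 _ _ (ae_filter_ringOfSetsType mu)) aer aei => x xr xi xab.
by split; [exact: xr|exact: xi].
Qed.

(** The chosen derivative of the test function is replaced by [derive1 phi] under the integral; one
    integration by parts then moves the derivative from [u] onto [derive1 phi]. *)
Lemma cint_wderiv_realext a b u phi (r : R) : a < b -> H1 a b u ->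
  C1 phi -> C1 (derive1 phi) ->
  cint `]a, b[ (fun x => r%:C * wderiv a b u x *
                  (wderiv a b (realext a b phi) x)^*) =
  r%:C * (u b * (derive1 phi b)%:C - u a * (derive1 phi a)%:C -
    cint `]a, b[ (fun x => u x * (derive1 (derive1 phi) x)%:C)).
Proof.
move=> ab H1u C1phi C1dphi.
have [cre cim _ _] := H1u.
have [[ur ui] /weak_derivE[wr wi]] := H1_wderiv H1u.
have [[vr vi] _] := H1_wderiv (H1_realext ab C1phi).
have aev := wderiv_realext ab C1phi.
have cdphi : {within `[a, b], continuous (derive1 phi)}.
  by case: C1phi => _; exact: continuous_subspaceT.
have FTCr := weak_FTC_mul ab cre (oointegrable_Lfun2 ur) wr C1dphi.
have FTCi := weak_FTC_mul ab cim (oointegrable_Lfun2 ui) wi C1dphi.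
set gu := wderiv a b u in ur ui wr wi FTCr FTCi *.
set gv := wderiv a b (realext a b phi) in vr vi aev *.
have iur := oointegrable_Lfun2 ur; have iui := oointegrable_Lfun2 ui.
have imr := oointegrableM iur cdphi; have imi := oointegrableM iui cdphi.
have Er : ooint a b (fun x => complex.Re (r%:C * gu x * (gv x)^*)) =
   r * ooint a b (fun x => reF gu x * derive1 phi x).
  rewrite -(ointZ r imr).
  apply: eq_ooint_ae.
  - have : oointegrable a b
        (fun x => r * (reF gu x * reF gv x) + r * (imF gu x * imF gv x)).
      exact: (oointegrableD (oointegrableZ r (oointegrable_mul_Lfun2 ur vr))
        (oointegrableZ r (oointegrable_mul_Lfun2 ui vi))).
    congr (oointegrable a b _); apply/funext => x; rewrite /reF /imF.
    by case: (gu x) => ? ?; case: (gv x) => ? ? /=; ring.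
  - exact: (oointegrableZ r imr).
  - apply: (@filterS _ _ (ae_filter_ringOfSetsType mu)) aev => x aev /aev [].
    rewrite /reF /imF.
    by case: (gu x) => ? ?; case: (gv x) => ? ? /= -> ->; ring.
have Ei : ooint a b (fun x => complex.Im (r%:C * gu x * (gv x)^*)) =
   r * ooint a b (fun x => imF gu x * derive1 phi x).
  rewrite -(ointZ r imi).
  apply: eq_ooint_ae.
  - have : oointegrable a b
        (fun x => r * (imF gu x * reF gv x) - r * (reF gu x * imF gv x)).
      exact: (oointegrableB (oointegrableZ r (oointegrable_mul_Lfun2 ui vr))
        (oointegrableZ r (oointegrable_mul_Lfun2 ur vi))).
    congr (oointegrable a b _); apply/funext => x; rewrite /reF /imF.
    by case: (gu x) => ? ?; case: (gv x) => ? ? /=; ring.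
  - exact: (oointegrableZ r imi).
  - apply: (@filterS _ _ (ae_filter_ringOfSetsType mu)) aev => x aev /aev [].
    rewrite /reF /imF.
    by case: (gu x) => ? ?; case: (gv x) => ? ? /= -> ->; ring.
have Fr : ooint a b (fun x => complex.Re (u x * (derive1 (derive1 phi) x)%:C)) =
    ooint a b (fun x => reF u x * derive1 (derive1 phi) x).
  by apply: eq_ooint => x _; rewrite Re_mulrC.
have Fi : ooint a b (fun x => complex.Im (u x * (derive1 (derive1 phi) x)%:C)) =
    ooint a b (fun x => imF u x * derive1 (derive1 phi) x).
  by apply: eq_ooint => x _; rewrite Im_mulrC.
rewrite /cint.
(* The components of [cint] are folded into [ooint] by conversion, so that the real identities above
   apply. *)
rewrite -[X in X +i* _]/(ooint a b _) -[X in _ +i* X]/(ooint a b _).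
rewrite /reF /imF Er Ei FTCr FTCi.
rewrite -[X in _ = _ * (_ - (X +i* _))]/(ooint a b _).
rewrite -[X in _ = _ * (_ - (_ +i* X))]/(ooint a b _).
rewrite Fr Fi /reF /imF.
move: (ooint _ _ _) (ooint _ _ _) => A B.
by case: (u a) => ? ?; case: (u b) => ? ? /=; congr (_ +i* _) => /=; ring.
Qed.

Lemma cint0 a b : cint `]a, b[ (fun=> 0 : R[i]) = 0.
Proof.
have E : ooint a b (fun=> 0 : R) = 0.
  by rewrite /ooint /Rintegral integral0.
by rewrite /cint -[RHS]/(0 +i* 0); congr (_ +i* _); exact: E.
Qed.

Lemma oointegrable_H1 a b (v : R -> R[i]) : H1 a b v ->
  [/\ oointegrable a b (reF v), oointegrable a b (imF v) &
      oointegrable a b (fun x => reF v x ^+ 2) /\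
      oointegrable a b (fun x => imF v x ^+ 2)].
Proof.
move=> [cr ci _ _]; have ir := oointegrable_within cr.
have ii := oointegrable_within ci.
by split=> //; split; [exact: (oointegrableM ir cr)|exact: (oointegrableM ii ci)].
Qed.

End ComplexValued.

(** * Estimates on the network *)

(** The partial inverse decides membership in the image classically and falls back on [dflt] outside
    it. *)
Lemma pinv_out T U (dflt : U -> T) (A : set T) (f : T -> U) y :
  ~ (f @` A) y -> 'pinv_dflt A f y = dflt y.
Proof.
rewrite /pinv_ splitV => fAy.
have -> : 'oinv_([fun f in A]) y =
  'oinv_(((fun _ => id) : set_surj A (f @` A) f)) y by [].
by rewrite oinv_surj; case: pselect.
Qed.

(** * The oscillating test function on the first edge *)

Section TestFunction.
Context {R : realType}.
Implicit Types (f g p : R -> R) (nu x : R).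

Lemma C1_is_derive f g : (forall x, is_derive x 1 f (g x)) -> continuous g ->
  C1 f /\ derive1 f = g.
Proof.
move=> fg cg; have fE : derive1 f = g.
  by apply/funext => x; rewrite derive1E; have [_ ->] := fg x.
by split=> //; split; [move=> x; have [] := fg x|rewrite fE].
Qed.

Lemma C1D f g : C1 f -> C1 g -> C1 (fun x => f x + g x) /\
  derive1 (fun x => f x + g x) = fun x => derive1 f x + derive1 g x.
Proof.
move=> [df cf] [dg cg]; apply: C1_is_derive.
  by move=> x; rewrite !derive1E; apply: is_deriveD; apply: DeriveDef.
by move=> x; apply: cvgD; [exact: cf|exact: cg].
Qed.

Lemma C1_cst (k : R) : C1 (cst k) /\ derive1 (cst k) = cst 0.
Proof.
by apply: C1_is_derive => x; exact: cvg_cst.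
Qed.

Lemma C1_onem_sqr : C1 (fun x : R => (1 - x) ^+ 2) /\
  derive1 (fun x : R => (1 - x) ^+ 2) = fun x => - 2 * (1 - x).
Proof.
apply: C1_is_derive => [x|x].
  apply: (@is_derive_quadratic _ _ 1) => // h.
  by rewrite (_ : _ - _ = h ^+ 2) ?mul1r ?ger0_norm ?sqr_ge0//; ring.
apply: cvgM; first exact: cvg_cst.
by apply: cvgB; [exact: cvg_cst|exact: cvg_id].
Qed.

Lemma C1_onem : C1 (fun x : R => - 2 * (1 - x)) /\
  derive1 (fun x : R => - 2 * (1 - x)) = cst 2.
Proof.
apply: C1_is_derive => [x|x]; last exact: cvg_cst.
apply: (@is_derive_quadratic _ _ 0) => // h.
by rewrite (_ : _ - _ = 0) ?normr0 ?mul0r//; rewrite /cst; ring.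
Qed.

Lemma is_derive_scale nu x : is_derive x 1 (fun y : R => nu * y) nu.
Proof.
apply: (@is_derive_quadratic _ _ 0) => // h.
by rewrite (_ : _ - _ = 0) ?normr0 ?mul0r//; ring.
Qed.

Lemma continuous_scale nu : continuous (fun y : R => nu * y).
Proof. by move=> x; apply: cvgM; [exact: cvg_cst|exact: cvg_id]. Qed.

Lemma C1_sin nu : C1 (fun x => sin (nu * x)) /\
  derive1 (fun x => sin (nu * x)) = fun x => cos (nu * x) * nu.
Proof.
apply: C1_is_derive => [x|x].
  apply: (@is_derive1_comp _ sin (fun y => nu * y)); exact: is_derive_scale.
apply: cvgM; last exact: cvg_cst.
by apply: (@continuous_comp _ _ _ _ cos);
  [exact: continuous_scale|exact: continuous_cos].
Qed.

Lemma C1_cos nu : C1 (fun x => cos (nu * x) * nu) /\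
  derive1 (fun x => cos (nu * x) * nu) = fun x => - sin (nu * x) * nu * nu.
Proof.
apply: C1_is_derive => [x|x].
  have -> : (fun x => cos (nu * x) * nu) = (nu \*o (fun x => cos (nu * x))).
    by apply/funext => y /=; rewrite mulrC.
  rewrite mulrC -[_ * _]/(nu *: _).
  apply: is_deriveZ.
  apply: (@is_derive1_comp _ cos (fun y => nu * y)); exact: is_derive_scale.
apply: cvgM; last exact: cvg_cst.
apply: cvgM; last exact: cvg_cst.
apply: cvgN.
by apply: (@continuous_comp _ _ _ _ sin);
  [exact: continuous_scale|exact: continuous_sin].
Qed.

(** The double zero at [1] removes the trace of [u] there and permits extension by [0] to the other
    edges. The zero at [0] removes the source term, and the slope [nu] at [0] brings out the trace
    of [u]. *)
Definition sin_bump nu x : R := (1 - x) ^+ 2 * sin (nu * x).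

Lemma derive1_sin_bump nu : C1 (sin_bump nu) /\ derive1 (sin_bump nu) =
  fun x => - 2 * (1 - x) * sin (nu * x) + (1 - x) ^+ 2 * (cos (nu * x) * nu).
Proof.
have [Cp dp] := C1_onem_sqr; have [Cs ds] := C1_sin nu.
by split; [exact: C1M|rewrite /sin_bump (derive1_mul Cp Cs) dp ds].
Qed.

(** The only term of order [nu ^+ 2] is isolated as a multiple of [sin_bump] itself, ready to cancel
    against the leading part of [lam ^+ 2]. *)
Lemma derive2_sin_bump nu : C1 (derive1 (sin_bump nu)) /\
  derive1 (derive1 (sin_bump nu)) =
  fun x => 2 * sin (nu * x) - 4 * nu * (1 - x) * cos (nu * x)
           - nu ^+ 2 * sin_bump nu x.
Proof.
have [Cp dp] := C1_onem_sqr; have [Cs ds] := C1_sin nu.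
have [Cp' dp'] := C1_onem; have [Cc dc] := C1_cos nu.
have [_ ->] := derive1_sin_bump nu.
have [C d] := C1D (C1M Cp' Cs) (C1M Cp Cc).
split=> //; rewrite d (derive1_mul Cp' Cs) (derive1_mul Cp Cc) dp ds dp' dc.
apply/funext => x.
by rewrite /sin_bump/=; ring.
Qed.

End TestFunction.

(** * The Cauchy-Schwarz inequality on the unit interval *)

Section CauchySchwarz.
Context {R : realType}.

Lemma ooint_cst (k : R) : ooint 0 1 (cst k) = k.
Proof.
rewrite /ooint Rintegral_cst//= lebesgue_measure_itv/= lte_fin ltr01.
by rewrite -EFinD/= subr0 mulr1.
Qed.

(** Integrate [(h - m) ^+ 2 >= 0], where [m] is the mean of [h]; the interval has length [1]. *)
Lemma sqr_ooint_le (h : R -> R) : oointegrable 0 1 h ->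
  oointegrable 0 1 (fun x => h x ^+ 2) ->
  ooint 0 1 h ^+ 2 <= ooint 0 1 (fun x => h x ^+ 2).
Proof.
move=> ih ih2; set m := ooint 0 1 h.
have ic : oointegrable 0 1 (cst (m ^+ 2)).
  by apply: oointegrable_within => ?; exact: cvg_cst.
have : 0 <= ooint 0 1 (fun x => h x ^+ 2 - (2 * m) * h x + m ^+ 2).
  by apply: ooint_ge0 => x; rewrite (_ : _ + _ = (h x - m) ^+ 2) ?sqr_ge0//; ring.
rewrite (ointD _ ic); last by apply: oointegrableB => //; exact: oointegrableZ.
rewrite ooint_cst ointB//; last exact: oointegrableZ.
by rewrite ointZ// -/m; lra.
Qed.

End CauchySchwarz.

(** * Test vectors supported on the first edge, and the forms evaluated on the diagonal *)

Section Network.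
Context {R : realType} {n : nat} (rho : 'I_n.+1 -> R).
Implicit Types (u : @vec R n) (phi : R -> R) (lam : R[i]).

Let ltjS (j : 'I_n.+1) : (j%:R : R) < j.+1%:R.
Proof. by rewrite ltr_nat. Qed.

(** The zero components are also written with [realext], so that [cint_wderiv_realext] serves on
    every edge. *)
Definition testvec phi : @vec R n :=
  fun j => realext j%:R j.+1%:R (if j == ord0 then phi else cst 0).

Let C1_testvec phi (j : 'I_n.+1) : C1 phi ->
  C1 (if j == ord0 then phi else cst 0).
Proof. by case: ifP => // _ _; exact: (C1_cst 0).1. Qed.

Lemma testvec0 phi : phi 0 = 0 -> testvec phi ord0 0 = 0.
Proof.
by rewrite /testvec /realext eqxx in_itv/= lexx ler01 => ->.
Qed.

Lemma testvecN0 phi j x : j != ord0 -> testvec phi j x = 0.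
Proof. by rewrite /testvec /realext => /negbTE ->; case: ifP. Qed.

Lemma testvecE phi x : 0 <= x <= 1 -> testvec phi ord0 x = (phi x)%:C.
Proof. by rewrite /testvec /realext eqxx in_itv/= => ->. Qed.

Lemma testvec_V phi : C1 phi -> phi 1 = 0 -> V (testvec phi).
Proof.
move=> C1phi phi1.
(* Vanishing at every right end yields both the Dirichlet condition and continuity at the inner
   nodes; for [n = 0] the first edge is also the last. *)
have end0 (i : 'I_n.+1) : testvec phi i i.+1%:R = 0.
  have [->|i0] := eqVneq i ord0; last exact: testvecN0.
  by rewrite testvecE ?phi1// ler01 lexx.
split.
- by move=> j; apply: H1_realext => //; exact: C1_testvec.
- exact: (end0 ord_max).
- move=> i j ij; rewrite ij end0 -ij testvecN0//.
  by rewrite -val_eqE/= ij.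
Qed.

Lemma dotH_testvec u phi :
  dotH u (testvec phi) = cint `]0, 1[ (fun x => u ord0 x * (phi x)%:C).
Proof.
rewrite /dotH big_ord_recl big1 ?addr0 => [|j _].
  have E x : 0 < x < 1 -> u ord0 x * (testvec phi ord0 x)^* = u ord0 x * (phi x)%:C.
    move=> /andP[x0 x1]; rewrite testvecE ?ltW//.
    by congr (_ * _); exact: conjc_real.
  rewrite /cint; congr (_ +i* _); apply: eq_ooint => x /E.
    by rewrite /reF => ->.
  by rewrite /imF => ->.
rewrite (_ : (fun x => _) = fun=> 0) ?cint0//.
by apply/funext => x; rewrite testvecN0// rmorph0 mulr0.
Qed.

Lemma dotV_testvec u phi : V u -> C1 phi -> C1 (derive1 phi) ->
  dotV rho u (testvec phi) = (rho ord0)%:C *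
    (u ord0 1 * (derive1 phi 1)%:C - u ord0 0 * (derive1 phi 0)%:C -
     cint `]0, 1[ (fun x => u ord0 x * (derive1 (derive1 phi) x)%:C)).
Proof.
move=> [H1u _ _] C1phi C1dphi.
have [C10 d0] := C1_cst (0 : R).
rewrite /dotV big_ord_recl big1 ?addr0 => [|j _].
  by rewrite /dx /testvec eqxx cint_wderiv_realext//; exact: (H1u ord0).
rewrite /dx /testvec /= cint_wderiv_realext ?d0 ?ltr_nat//; last exact: H1u.
rewrite (_ : (fun x => _) = fun=> 0) ?cint0 ?mulr0 ?subr0 ?mulr0//.
by apply/funext => x; rewrite ?d0 mulr0.
Qed.

Definition sqnorm u : R :=
  \sum_(j < n.+1) ooint j%:R j.+1%:R (fun x => reF (u j) x ^+ 2 + imF (u j) x ^+ 2).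

Lemma dotH_self u lam : V u ->
  dotH (fun j x => lam * u j x) u = lam * (sqnorm u)%:C.
Proof.
move=> [H1u _ _]; rewrite /dotH /sqnorm rmorph_sum mulr_sumr.
apply: eq_bigr => j _.
have [_ _ [ir ii]] := oointegrable_H1 (H1u j).
have i2 := oointegrableD ir ii.
pose nu2 := ooint j%:R j.+1%:R (fun x => reF (u j) x ^+ 2 + imF (u j) x ^+ 2).
transitivity ((complex.Re lam * nu2) +i* (complex.Im lam * nu2)).
  rewrite /nu2 -!ointZ//; congr (_ +i* _); apply: eq_ooint => x _; rewrite /reF /imF.
    by case: lam => ? ?; case: (u j x) => ? ? /=; ring.
  by case: lam => ? ?; case: (u j x) => ? ? /=; ring.
by rewrite -/nu2; case: lam => ? ? /=; congr (_ +i* _) => /=; ring.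
Qed.

(** The energy estimate needs only that this term is real and nonnegative, hence the existential
    form. *)
Lemma dotV_self u : (forall j, 0 < rho j) ->
  exists2 b : R, 0 <= b & dotV rho u u = b%:C.
Proof.
move=> rho0.
exists (\sum_(j < n.+1) ooint j%:R j.+1%:R
   (fun x => rho j * (reF (dx u j) x ^+ 2 + imF (dx u j) x ^+ 2))).
  apply: sumr_ge0 => j _; apply: ooint_ge0 => x.
  by apply: mulr_ge0; [exact: ltW|rewrite addr_ge0// sqr_ge0].
rewrite /dotV rmorph_sum; apply: eq_bigr => j _.
rewrite -[RHS]/(_ +i* 0) -[X in _ = _ +i* X](_ : ooint j%:R j.+1%:R (fun=> 0 : R) = 0).
  congr (_ +i* _); apply: eq_ooint => x _; rewrite /reF /imF;
    by case: (dx u j x) => ? ? /=; ring.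
by rewrite /ooint /Rintegral integral0.
Qed.

End Network.

(** * Complex moduli and pointwise bounds on the test function *)

Section Bounds.
Context {R : realType}.

Lemma Re_le_normc (z : R[i]) : complex.Re z <= Normc.normc z.
Proof.
case: z => x y /=; apply: (le_trans (ler_norm x)).
by rewrite -sqrtr_sqr ler_wsqrtr// lerDl sqr_ge0.
Qed.

Lemma normc_ge0 (z : R[i]) : 0 <= Normc.normc z.
Proof. by case: z => x y; exact: sqrtr_ge0. Qed.

Lemma normc_sqr (z : R[i]) :
  Normc.normc z ^+ 2 = complex.Re z ^+ 2 + complex.Im z ^+ 2.
Proof. by case: z => x y /=; rewrite sqr_sqrtr// addr_ge0// sqr_ge0. Qed.

Lemma normc_real (x : R) : Normc.normc x%:C = `|x|.
Proof. by rewrite /= expr0n/= addr0 sqrtr_sqr. Qed.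

(** With [lam = g + i e] and [c ^+ 2 = rho_0], these are the real and imaginary parts of
    [lam ^+ 2 * phi - rho_0 * phi'']. Since [c ^+ 2 * (mu / c) ^+ 2 = e ^+ 2 + 2 * |e| + 1], the
    terms in [e ^+ 2] cancel; the remaining constants are absorbed by [mu >= 1]. *)
Lemma sin_bump_bound (g e c x : R) : 0 < g -> 0 < c -> 0 < x < 1 ->
  let mu : R := `|e| + 1 in let phi := sin_bump (mu / c) in
  `|(g ^+ 2 - e ^+ 2) * phi x - c ^+ 2 * derive1 (derive1 phi) x|
    <= (g ^+ 2 + 2 + 2 * c ^+ 2 + 4 * c) * mu /\
  `|2 * g * e * phi x| <= 2 * g * mu.
Proof.
move=> g0 c0 /andP[x0 x1] mu phi.
have cN0 : c != 0 by rewrite gt_eqF.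
have [_ d2] := derive2_sin_bump (mu / c); rewrite /phi d2 /sin_bump.
have e0 : 0 <= `|e| by [].
have mu1 : 1 <= mu by rewrite /mu lerDr.
have S1 : `|sin (mu / c * x)| <= 1 by rewrite ler_norml sin_geN1 sin_le1.
have C1 : `|cos (mu / c * x)| <= 1 by rewrite ler_norml cos_geN1 cos_le1.
move: (sin _) (cos _) S1 C1 => S C S1 C1.
have q1 : `|1 - x| <= 1 by rewrite ler_norml; lra.
have p1 : `|(1 - x) ^+ 2 * S| <= 1 by rewrite normrM normrX mulr_ile1// exprn_ile1.
have r1 : `|(1 - x) * C| <= 1 by rewrite normrM mulr_ile1.
have aux (A X : R) : 0 <= A -> `|X| <= 1 -> `|A * X| <= A.
  by move=> A0 X1; rewrite normrM ger0_norm// ler_piMr.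
split.
  have -> : (g ^+ 2 - e ^+ 2) * ((1 - x) ^+ 2 * S) - c ^+ 2 *
      (2 * S - 4 * (mu / c) * (1 - x) * C - (mu / c) ^+ 2 * ((1 - x) ^+ 2 * S)) =
      (g ^+ 2 + 1 + 2 * `|e|) * ((1 - x) ^+ 2 * S) - 2 * c ^+ 2 * S +
      4 * c * mu * ((1 - x) * C).
    rewrite -[e ^+ 2]real_normK ?num_real// /mu.
    by field.
  apply: (le_trans (ler_normD _ _)).
  apply: (le_trans (lerD (ler_normB _ _) (lexx _))).
  have A0 : 0 <= g ^+ 2 + 1 + 2 * `|e| by rewrite !addr_ge0// ?sqr_ge0// mulr_ge0.
  have B0 : 0 <= 2 * c ^+ 2 by rewrite mulr_ge0// sqr_ge0.
  have D0 : 0 <= 4 * c * mu by rewrite !mulr_ge0// ltW// (lt_le_trans _ mu1).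
  have := aux _ _ A0 p1; have := aux _ _ B0 S1; have := aux _ _ D0 r1.
  have g2 : 0 <= g ^+ 2 * `|e| by rewrite mulr_ge0// sqr_ge0.
  have c2 : 0 <= c ^+ 2 * `|e| by rewrite mulr_ge0// sqr_ge0.
  move: (`|_ * _|) (`|_ * _|) (`|_ * _|) => X Y Z; rewrite /mu; nra.
have g20 : 0 <= 2 * g by rewrite mulr_ge0 // ltW.
rewrite -mulrA normrM (ger0_norm g20) ler_wpM2l// normrM.
by rewrite (le_trans (ler_wpM2l e0 p1))// mulr1 /mu; lra.
Qed.

End Bounds.

(** * Energy estimate, trace estimate and their combination *)

Section Estimates.
Context {R : realType} {n : nat} (rho : 'I_n.+1 -> R).
Implicit Types (u v : @vec R n) (lam k : R[i]).

Lemma Lop_eval lam u k v : V v -> Lop rho lam u = Cop rho k ->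
  dotH (fun j x => lam ^+ 2 * u j x) v + dotV rho u v =
  k * ((Num.sqrt (rho ord0))^-1)%:C * (v ord0 0)^*.
Proof. by move=> Vv /(congr1 (fun F => F (exist _ v (mem_set Vv)))). Qed.

Lemma energy_le lam u k : (forall j, 0 < rho j) -> 0 < complex.Re lam ->
  V u -> Lop rho lam u = Cop rho k ->
  complex.Re lam * Normc.normc lam ^+ 2 * sqnorm u <=
  Normc.normc lam * (Normc.normc k * (Num.sqrt (rho ord0))^-1 *
    Normc.normc (u ord0 0)).
Proof.
move=> rho0 lam0 Vu /(Lop_eval Vu); rewrite dotH_self//.
have [b b0 ->] := dotV_self u rho0.
set s := (Num.sqrt _)^-1; set z := k * s%:C * _ => E.
have s0 : 0 <= s by rewrite invr_ge0 sqrtr_ge0.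
have -> : Normc.normc k * s * Normc.normc (u ord0 0) = Normc.normc z.
  rewrite /z !Normc.normcM normc_real (ger0_norm s0); congr (_ * _).
  by case: (u ord0 0) => x y /=; rewrite sqrrN.
have -> : Normc.normc lam * Normc.normc z = Normc.normc (lam^* * z).
  rewrite (Normc.normcM lam^* z); congr (_ * _).
  by case: (lam) => x y /=; rewrite sqrrN.
apply: le_trans (Re_le_normc _); rewrite -E normc_sqr.
case: (lam) lam0 => x y /= x0.
rewrite -subr_ge0 (_ : _ - _ = x * b); first by rewrite mulr_ge0// ltW.
by ring.
Qed.

(** The sum of the two constants of [sin_bump_bound], hence a common bound for both parts that does
    not depend on the imaginary part of [lam]. *)
Definition trace_const (g c : R) : R :=
  g ^+ 2 + 2 + 2 * c ^+ 2 + 4 * c + 2 * g.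

Lemma sqnorm_ge u :
  ooint 0 1 (fun x => reF (u ord0) x ^+ 2 + imF (u ord0) x ^+ 2) <= sqnorm u.
Proof.
rewrite /sqnorm big_ord_recl lerDl sumr_ge0// => j _.
by apply: ooint_ge0 => x; rewrite addr_ge0// sqr_ge0.
Qed.

(** Testing with [sin_bump] gives a factor [mu] on both sides, which cancels and leaves a constant
    independent of the imaginary part of [lam]. The factor [4] is [2] for the real and imaginary
    parts of the trace, times [2] from [m ^+ 2 <= 2 * sqnorm u]. *)
Lemma trace_le lam u k : (forall j, 0 < rho j) -> 0 < complex.Re lam ->
  V u -> Lop rho lam u = Cop rho k ->
  rho ord0 * Normc.normc (u ord0 0) ^+ 2 <=
  4 * trace_const (complex.Re lam) (Num.sqrt (rho ord0)) ^+ 2 * sqnorm u.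
Proof.
move=> rho0 lam0 Vu Lu.
set g := complex.Re lam in lam0 *; set c := Num.sqrt (rho ord0).
set K := trace_const g c; pose e := complex.Im lam.
have c0 : 0 < c by rewrite sqrtr_gt0.
have cN0 : c != 0 by rewrite gt_eqF.
have rhoE : rho ord0 = c ^+ 2 by rewrite sqr_sqrtr// ltW.
pose mu : R := `|e| + 1; pose phi := sin_bump (mu / c).
have mu0 : 0 < mu by rewrite /mu ltr_wpDl.
have [C1phi d1] := derive1_sin_bump (mu / c).
have [C1dphi d2] := derive2_sin_bump (mu / c).
rewrite -/phi in C1phi d1 C1dphi d2.
have phi0 : phi 0 = 0 by rewrite /phi /sin_bump mulr0 sin0 mulr0.
have phi1 : phi 1 = 0 by rewrite /phi /sin_bump subrr expr0n/= mul0r.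
have dphi1 : derive1 phi 1 = 0.
  by rewrite d1 subrr expr0n/= mulr0 !mul0r addr0.
have dphi0 : derive1 phi 0 = mu / c.
  by rewrite d1 mulr0 sin0 cos0 mulr0 add0r subr0 expr1n !mul1r.
(* The right-hand side vanishes by [phi0], and the boundary term at [1] by [dphi1]. *)
have := Lop_eval (testvec_V C1phi phi1) Lu.
rewrite testvec0// rmorph0 mulr0 dotH_testvec dotV_testvec// dphi1 dphi0 rhoE.
pose U := reF (u ord0); pose W := imF (u ord0).
have [H1u _ _] := Vu; have H1u0 : H1 0 1 (u ord0) := H1u ord0.
have [iU iW [iU2 iW2]] := oointegrable_H1 H1u0.
rewrite -/U -/W in iU iW iU2 iW2.
pose m := ooint 0 1 (fun x => `|U x| + `|W x|).
have iUW : oointegrable 0 1 (fun x => `|U x| + `|W x|).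
  by apply: oointegrableD; exact: oointegrable_norm.
have wC (h : R -> R) : continuous h -> {within `[0, 1], continuous h}.
  by move=> ch; exact: continuous_subspaceT.
have cphi := wC _ (continuous_C1 C1phi).
have cd2 := wC _ C1dphi.2.
set d2phi := derive1 (derive1 phi) in cd2 d2 *.
pose L := g ^+ 2 - e ^+ 2; pose M := 2 * g * e.
(* The real and imaginary parts of the tested equation, with [(X, Y)] equal to
   [(U, W)] and [s = -1], respectively to [(W, U)] and [s = 1]. *)
have core (X Y : R -> R) (w s : R) :
    oointegrable 0 1 X -> oointegrable 0 1 Y -> `|s| = 1 ->
    (forall x, `|X x| + `|Y x| <= `|U x| + `|W x|) ->
    ooint 0 1 (fun x => (L * X x + s * M * Y x) * phi x) =
      c ^+ 2 * (w * (mu / c) + ooint 0 1 (fun x => X x * d2phi x)) ->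
    c * `|w| <= K * m.
  move=> iX iY s1 XY E.
  have iXp := oointegrableM iX cphi; have iYp := oointegrableM iY cphi.
  have iXd := oointegrableM iX cd2.
  pose F x := (L * (X x * phi x) + s * M * (Y x * phi x)) - c ^+ 2 * (X x * d2phi x).
  have iXY := oointegrableD (oointegrableZ L iXp) (oointegrableZ (s * M) iYp).
  have iF : oointegrable 0 1 F := oointegrableB iXY (oointegrableZ (c ^+ 2) iXd).
  (* The tested equation leaves only the boundary term [c ^+ 2 * (mu / c) * w]. *)
  have FE : ooint 0 1 F = c * mu * w.
    rewrite (ointB iXY (oointegrableZ (c ^+ 2) iXd)) (ointZ _ iXd).
    rewrite (_ : (fun x => _) = (fun x => (L * X x + s * M * Y x) * phi x)).
      by rewrite E; field.
    by apply/funext => x; ring.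
  have : `|c * mu * w| <= K * mu * m.
    rewrite -FE; apply: (le_trans (le_norm_ooint iF)).
    rewrite -(ointZ (K * mu) iUW); apply: le_ooint.
    - exact: oointegrable_norm.
    - exact: oointegrableZ.
    move=> x x01; have [b1 b2] := sin_bump_bound e lam0 c0 x01.
    have -> : F x = X x * (L * phi x - c ^+ 2 * d2phi x) + s * (Y x * (M * phi x)).
      by rewrite /F; ring.
    apply: (le_trans (ler_normD _ _)); rewrite (normrM s) s1 mul1r.
    rewrite !(normrM (X x)) !(normrM (Y x)).
    have K1 : g ^+ 2 + 2 + 2 * c ^+ 2 + 4 * c <= K.
      by rewrite /K /trace_const lerDl mulr_ge0// ltW.
    have K2 : 2 * g <= K.
      by rewrite /K /trace_const lerDr !addr_ge0// ?sqr_ge0// mulr_ge0// ?sqr_ge0// ltW.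
    have K0 : 0 <= K * mu.
      by rewrite mulr_ge0 ?(ltW mu0)//; apply: le_trans K2; rewrite mulr_ge0// ltW.
    have b1' : `|L * phi x - c ^+ 2 * d2phi x| <= K * mu.
      by apply: (le_trans b1); rewrite ler_wpM2r// ltW.
    have b2' : `|M * phi x| <= K * mu.
      by apply: (le_trans b2); rewrite ler_wpM2r// ltW.
    apply: (le_trans (lerD (ler_wpM2l (normr_ge0 _) b1')
      (ler_wpM2l (normr_ge0 _) b2'))).
    by rewrite -mulrDl mulrC ler_wpM2l.
  rewrite !normrM (gtr0_norm c0) (gtr0_norm mu0).
  by rewrite (mulrAC c) (mulrAC K) ler_pM2r.
(* Cauchy-Schwarz, followed by [(p + q) ^+ 2 <= 2 * (p ^+ 2 + q ^+ 2)] pointwise. *)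
have m2 : m ^+ 2 <= 2 * sqnorm u.
  have i1 : oointegrable 0 1 (fun x => (`|U x| + `|W x|) ^+ 2).
    have [cr ci _ _] := H1u0.
    apply: (oointegrableM iUW) => x.
    by apply: cvgD; apply: cvg_norm; [exact: cr|exact: ci].
  have iS := oointegrableD iU2 iW2.
  apply: (le_trans (sqr_ooint_le iUW i1)).
  apply: (le_trans _ (ler_wpM2l _ (sqnorm_ge u))) => //.
  rewrite -/U -/W -(ointZ 2 iS); apply: le_ooint => //.
    exact: oointegrableZ.
  move=> x _; rewrite -[U x ^+ 2]real_normK ?num_real//.
  rewrite -[W x ^+ 2]real_normK ?num_real//.
  by have := sqr_ge0 (`|U x| - `|W x|); nra.
have lamE : lam = g +i* e by rewrite /g /e; case: (lam).
have EX : cint `]0, 1[ (fun x => lam ^+ 2 * u ord0 x * (phi x)%:C) =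
    (ooint 0 1 (fun x => (L * U x + -1 * M * W x) * phi x)) +i*
    (ooint 0 1 (fun x => (L * W x + 1 * M * U x) * phi x)).
  rewrite /cint; congr (_ +i* _); apply: eq_ooint => x _.
    rewrite /reF Re_mulrC /U /W /reF /imF /L /M {1}lamE; congr (_ * _).
    by case: (u ord0 x) => ? ?; rewrite expr2 /=; ring.
  rewrite /imF Im_mulrC /U /W /reF /imF /L /M {1}lamE; congr (_ * _).
  by case: (u ord0 x) => ? ?; rewrite expr2 /=; ring.
have EY : cint `]0, 1[ (fun x => u ord0 x * (d2phi x)%:C) =
    (ooint 0 1 (fun x => U x * d2phi x)) +i*
    (ooint 0 1 (fun x => W x * d2phi x)).
  rewrite /cint; congr (_ +i* _); apply: eq_ooint => x _.
    by rewrite /reF Re_mulrC.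
  by rewrite /imF Im_mulrC.
rewrite EX EY normc_sqr => /eqP; rewrite eq_complex => /andP[/eqP Er /eqP Ei].
have Hr : c * `|complex.Re (u ord0 0)| <= K * m.
  apply: (core U W _ (-1)) => //; first by rewrite normrN normr1.
  by move: Er; case: (u ord0 0) => a b; case: (u ord0 1) => a' b' /=; lra.
have Hi : c * `|complex.Im (u ord0 0)| <= K * m.
  apply: (core W U _ 1) => //; [by rewrite normr1|by move=> x; rewrite addrC|].
  by move: Ei; case: (u ord0 0) => a b; case: (u ord0 1) => a' b' /=; lra.
have sq (w : R) : c * `|w| <= K * m -> c ^+ 2 * w ^+ 2 <= K ^+ 2 * m ^+ 2.
  move=> H; rewrite -[w ^+ 2]real_normK ?num_real// -!exprMn.
  have cw : 0 <= c * `|w| by rewrite mulr_ge0// ltW.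
  by rewrite ler_sqr ?nnegrE//; exact: le_trans H.
have := sq _ Hr; have := sq _ Hi.
have := ler_wpM2l (sqr_ge0 K) m2.
rewrite mulrDr; lra.
Qed.

(** Inserting [energy_le] into [trace_le] bounds the square of [y = |lam| |u_0(0)|] by a constant
    multiple of [y], hence [y] by that constant. *)
Lemma transfer_le lam k : (forall j, 0 < rho j) -> 0 < complex.Re lam ->
  Normc.normc k <= 1 ->
  Normc.normc (transfer rho lam k) <=
  (Num.sqrt (rho ord0))^-1 * (4 *
    trace_const (complex.Re lam) (Num.sqrt (rho ord0)) ^+ 2 / rho ord0 *
    (Num.sqrt (rho ord0))^-1 / complex.Re lam).
Proof.
move=> rho0 lam0 k1; rewrite /transfer.
set s := (Num.sqrt _)^-1; set K := trace_const _ _.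
have s0 : 0 < s by rewrite invr_gt0 sqrtr_gt0.
pose u := resolvent rho lam (Cop rho k).
rewrite -/u; rewrite /Cstar -/s !Normc.normcM normc_real (gtr0_norm s0) mulrCA.
apply: ler_wpM2l; first exact: ltW.
have B0 : 0 <= 4 * K ^+ 2 / rho ord0 * s / complex.Re lam.
  apply: divr_ge0 (ltW lam0); apply: mulr_ge0 (ltW s0).
  by apply: divr_ge0 (ltW (rho0 _)); rewrite mulr_ge0 ?sqr_ge0.
(* Outside the image of [V] the resolvent is the default [0], and the bound reduces to [B0]. *)
have [im|im] := pselect ((Lop rho lam @` V) (Cop rho k)); last first.
  by rewrite /u /resolvent (pinv_out _ im) /= expr0n/= addr0 sqrtr0 mulr0.
have Vu : V u.
  have surjL : set_surj V (Lop rho lam @` V) (Lop rho lam) by [].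
  by apply: (surjpinv_image_sub (dflt := fun=> 0 : vec) surjL); exists (Cop rho k).
have Lu : Lop rho lam u = Cop rho k by apply: pinvK; rewrite inE.
have h1 := energy_le rho0 lam0 Vu Lu; have h2 := trace_le rho0 lam0 Vu Lu.
rewrite -/s -/K in h1 h2.
set g := complex.Re lam in lam0 h1 *; set r := rho ord0 in h2 *.
have r0 : 0 < r := rho0 ord0.
set A := sqnorm u in h1 h2; set N := Normc.normc lam in h1 *.
set w := Normc.normc (u ord0 0) in h1 h2 *.
have N0 : 0 <= N := normc_ge0 lam.
have w0 : 0 <= w := normc_ge0 (u ord0 0).
set y : R := N * w.
have y0 : 0 <= y by rewrite mulr_ge0.
have e1 : g * N ^+ 2 * A <= s * y.
  apply: (le_trans h1).
  rewrite (_ : _ * _ = Normc.normc k * (s * y)); last by rewrite /y; ring.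
  by rewrite ler_piMl// mulr_ge0// ltW.
(* [trace_le] multiplied by [g * N ^+ 2] produces the left side of [e1]. *)
have key : g * r * y ^+ 2 <= 4 * K ^+ 2 * s * y.
  have gN : 0 <= g * N ^+ 2 by rewrite mulr_ge0 ?sqr_ge0// ltW.
  have := ler_wpM2l gN h2.
  have K0 : 0 <= 4 * K ^+ 2 by rewrite mulr_ge0// sqr_ge0.
  have := ler_wpM2l K0 e1.
  rewrite /y; lra.
(* The factor [y] can be cancelled only when it is nonzero; otherwise [B0] suffices. *)
have [->//|yN0] := eqVneq y 0.
have y1 : 0 < y by rewrite lt_neqAle eq_sym yN0.
rewrite (_ : 4 * _ / r * s / g = 4 * K ^+ 2 * s / (g * r)); last first.
  by field; rewrite !gt_eqF.
rewrite ler_pdivlMr ?mulr_gt0// -(ler_pM2r y1).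
by rewrite (_ : y * _ * y = g * r * y ^+ 2)//; ring.
Qed.

End Estimates.

Theorem lemma4p1 (R : realType) (n : nat) (rho : 'I_n.+1 -> R)
    (rho_gt0 : forall j, 0 < rho j) (gamma : R) (gamma_gt0 : 0 < gamma) :
  (ereal_sup [set opnorm (transfer rho lam)
               | lam in [set lam : R[i] | complex.Re lam = gamma]] < +oo)%E.
Proof.
(* The bound involves [lam] only through its real part, which is fixed to [gamma]. *)
pose s := (Num.sqrt (rho ord0))^-1.
pose B := s * (4 * trace_const gamma (Num.sqrt (rho ord0)) ^+ 2 / rho ord0 * s / gamma).
apply: (@le_lt_trans _ _ B%:E); last exact: ltry.
apply: ub_ereal_sup => _ [lam /= lamE <-].
apply: ub_ereal_sup => _ [k /= k1 <-].
by rewrite lee_fin /B -lamE; apply: transfer_le => //; rewrite lamE.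
Qed.
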